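(* Suppose $A\in\mathbb{R}^{m\times n}$ is a full column-rank matrix and all rows of $A$ are nonzero. Then $$\overline{\chi}(A)=\max\left\{\mathcal{G}(SA): S\in\mathscr{S},\ SA(\mathbb{R}^n)\cap\mathbb{R}^m_{++}\neq\emptyset\right\}.$$
   Context: $\mathbb{R}^d$ carries the Euclidean norm and matrices carry the induced operator norm $\|M\|=\max_{\|x\|\le 1}\|Mx\|$. $\mathbb{R}^m_{++}$ is the set of vectors in $\mathbb{R}^m$ with positive entries, and $A(\mathbb{R}^n):=\{Ax:x\in\mathbb{R}^n\}$. $\mathscr{S}:=\{\operatorname{Diag}(s): s\in\{-1,1\}^m\}\subseteq\mathbb{R}^{m\times m}$ is the set of signature matrices and $\mathscr{D}:=\{\operatorname{Diag}(d): d\in\mathbb{R}^m_{++}\}$ is the set of diagonal matrices with positive diagonal entries. For $A\in\mathbb{R}^{m\times n}$ of full column rank define $$\overline{\chi}(A):=\max_{D\in\mathscr{D}}\|A(A^{\mathsf T}DA)^{-1}A^{\mathsf T}D\|,$$ which is known to be finite. Grassmannian condition number: for linear subspaces $L,L'\subseteq\mathbb{R}^m$ of the same dimension let $\operatorname{dist}(L,L'):=\|\Pi_L-\Pi_{L'}\|$, where $\Pi_L,\Pi_{L'}$ are the orthogonal projection matrices onto $L,L'$. For $A\in\mathbb{R}^{m\times n}$ with $A(\mathbb{R}^n)\cap\mathbb{R}^m_{++}\neq\emptyset$, let $L:=A(\mathbb{R}^n)$ and $$\mathcal{G}(A):=\frac{1}{\min\{\operatorname{dist}(L,L'): L'\subseteq\mathbb{R}^m\text{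 a linear subspace},\ \dim L'=\dim L,\ L'\cap\mathbb{R}^m_{++}=\emptyset\}}.$$
   Formalization: The formal theorem assumes n < m, since for m = n no subspace L' exists and G(SA) is undefined (e.g. A = [1]); the max over D defining χ̄(A) is read as a supremum, since it need not be attained (e.g. A = (1,1)^T). *)

(* Defs.v *)
From mathcomp Require Import all_boot all_order all_algebra.
From mathcomp Require Import all_classical all_reals.

Set Implicit Arguments.
Unset Strict Implicit.
Unset Printing Implicit Defensive.

Import Order.TTheory GRing.Theory Num.Theory.

Local Open Scope classical_set_scope.
Local Open Scope ring_scope.

(* The norm that MathComp-Analysis puts on matrices is the sup norm of the
   entries, hence the explicit Euclidean norm. *)
Definition enorm (R : realType) (d : nat) (x : 'cV[R]_d) : R :=
  Num.sqrt (\sum_(i < d) x i 0 ^+ 2).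

Definition opnorm (R : realType) (p q : nat) (M : 'M[R]_(p, q)) : R :=
  sup [set enorm (M *m x) | x in [set x : 'cV[R]_q | enorm x <= 1]].

Definition pos_orthant (R : realType) (m : nat) : set 'cV[R]_m :=
  [set x | forall i, 0 < x i 0].
Arguments pos_orthant : clear implicits.

Definition signature_mx (R : realType) (m : nat) : set 'M[R]_m :=
  [set diag_mx s | s in [set s : 'rV[R]_m | forall i, s 0 i = -1 \/ s 0 i = 1]].
Arguments signature_mx : clear implicits.

Definition pos_diag_mx (R : realType) (m : nat) : set 'M[R]_m :=
  [set diag_mx d | d in [set d : 'rV[R]_m | forall i, 0 < d 0 i]].
Arguments pos_diag_mx : clear implicits.

(* This is a supremum, not attained in general: for A = (1, 1)^T the norms are
   sqrt 2 * sqrt (d1 ^ 2 + d2 ^ 2) / (d1 + d2) < sqrt 2.  The set is nonempty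
   and, when A has full column rank, bounded. *)
Definition chi_bar (R : realType) (m n : nat) (A : 'M[R]_(m, n)) : R :=
  sup [set opnorm (A *m invmx (A^T *m D *m A) *m A^T *m D)
      | D in pos_diag_mx R m].

Definition mximage (R : realType) (m n : nat) (A : 'M[R]_(m, n)) :
    {vspace 'cV[R]_m} :=
  limg (linfun (mulmx A : 'cV[R]_n -> 'cV[R]_m)).

Definition is_oproj (R : realType) (m : nat) (L : {vspace 'cV[R]_m})
    (P : 'M[R]_m) : Prop :=
  forall x : 'cV[R]_m,
    P *m x \in L /\ forall y, y \in L -> y^T *m (x - P *m x) = 0.

(* By is_oproj_exists and is_oproj_unique below the default 0 is never used. *)
Definition oproj (R : realType) (m : nat) (L : {vspace 'cV[R]_m}) : 'M[R]_m :=
  xget 0 [set P | is_oproj L P].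

Definition grass_dist (R : realType) (m : nat) (L L' : {vspace 'cV[R]_m}) : R :=
  opnorm (oproj L - oproj L').

Definition meets_pos (R : realType) (m : nat) (L : {vspace 'cV[R]_m}) : Prop :=
  [set x | x \in L] `&` pos_orthant R m !=set0.

(* The infimum is a minimum whenever the set is nonempty: the subspaces of a
   fixed dimension missing the open positive orthant form a closed subset of the
   compact Grassmannian.  The set is empty when L is the whole space; since
   inf set0 = 0 and 0^-1 = 0 the value is then a meaningless 0. *)
Definition grass_cond (R : realType) (m n : nat) (A : 'M[R]_(m, n)) : R :=
  let L := mximage A in
  (inf [set grass_dist L L'
       | L' in [set L' : {vspace 'cV[R]_m} |
                 \dim L' = \dim L /\ ~ meets_pos L']])^-1.

Definition is_maximum (R : realType) (X : set R) (x : R) : Prop :=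
  X x /\ ubound X x.

Lemma mximageP (R : realType) (m n : nat) (A : 'M[R]_(m, n)) (y : 'cV[R]_m) :
  y \in mximage A <-> exists x : 'cV[R]_n, y = A *m x.
Proof.
split; first by move=> /memv_imgP[x _ ->]; exists x; rewrite lfunE.
move=> [x ->]; apply/memv_imgP; exists x; first exact: memvf.
by rewrite lfunE.
Qed.

Lemma trmulmx_eq0 (R : realType) (m : nat) (z : 'cV[R]_m) :
  z^T *m z = 0 -> z = 0.
Proof.
move=> /matrixP/(_ 0 0); rewrite !mxE => /eqP.
rewrite psumr_eq0 => [/allP h|i _]; last by rewrite mxE -expr2 sqr_ge0.
apply/matrixP => i j; rewrite ord1 !mxE.
have := h i (mem_index_enum _); rewrite mxE -expr2 sqrf_eq0 => /eqP.
by [].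
Qed.

Lemma is_oproj_unique (R : realType) (m : nat) (L : {vspace 'cV[R]_m})
    (P Q : 'M[R]_m) : is_oproj L P -> is_oproj L Q -> P = Q.
Proof.
move=> hP hQ.
have PQ (x : 'cV[R]_m) : P *m x = Q *m x.
  have [Px oP] := hP x; have [Qx oQ] := hQ x.
  have zL : P *m x - Q *m x \in L by exact: rpredB.
  apply/eqP; rewrite -subr_eq0; apply/eqP/trmulmx_eq0.
  rewrite [X in _ *m X](_ : _ = (x - Q *m x) - (x - P *m x)).
    by rewrite mulmxBr oP// oQ// subrr.
  by rewrite [RHS]addrC opprB addrA subrK.
apply/matrixP => i j.
by have := PQ (delta_mx j 0); rewrite -!colE => /matrixP/(_ i 0); rewrite !mxE.
Qed.

Lemma is_oproj_exists (R : realType) (m : nat) (L : {vspace 'cV[R]_m}) :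
  exists P, is_oproj L P.
Proof.
pose b := vbasis L.
pose B : 'M[R]_(m, \dim L) := \matrix_(i, j) (b`_j) i 0.
have BE (c : 'cV[R]_(\dim L)) : B *m c = \sum_(j < \dim L) c j 0 *: b`_j.
  apply/matrixP => i j; rewrite ord1 mxE summxE.
  by apply: eq_bigr => k _; rewrite !mxE mulrC.
have BL (c : 'cV[R]_(\dim L)) : B *m c \in L.
  rewrite BE; apply: rpred_sum => j _; apply: rpredZ.
  by apply: vbasis_mem; apply: mem_nth; rewrite size_tuple.
have LB y : y \in L -> exists c, y = B *m c.
  move=> /coord_vbasis yE; exists (\col_j coord b j y).
  by rewrite BE {1}yE; apply: eq_bigr => j _; rewrite mxE.
have Bu : B^T *m B \in unitmx.
  rewrite -row_free_unit; apply: inj_row_free => v vB.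
  have : (B *m v^T)^T *m (B *m v^T) = 0.
    by rewrite trmx_mul trmxK mulmxA -(mulmxA v) vB mul0mx.
  move=> /trmulmx_eq0; rewrite BE => h0.
  have /freeP hb := basis_free (vbasisP L).
  apply/matrixP => i j; rewrite ord1 mxE.
  by have := hb _ h0 j; rewrite mxE.
exists (B *m invmx (B^T *m B) *m B^T) => x; split.
  by rewrite -!mulmxA; exact: BL.
move=> y /LB[c ->]; set z := x - _; rewrite trmx_mul -mulmxA.
suff -> : B^T *m z = 0 by rewrite mulmx0.
by rewrite mulmxBr !mulmxA mulmxV// mul1mx subrr.
Qed.

Lemma oprojP (R : realType) (m : nat) (L : {vspace 'cV[R]_m}) :
  is_oproj L (oproj L).
Proof. by have [P] := is_oproj_exists L; exact: xgetI. Qed.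

(* Main.v *)
Require Import Defs.
From mathcomp Require Import all_boot all_order all_algebra.
From mathcomp Require Import all_classical all_reals.
From mathcomp Require Import ring lra.

Import Order.TTheory GRing.Theory Num.Theory.

Local Open Scope classical_set_scope.
Local Open Scope ring_scope.

(* Write P for the orthogonal projection onto the image L of B, and suppose that
   L meets the open positive orthant.  A subspace L' misses that orthant exactly
   when it is orthogonal to some nonzero y >= 0 (Gordan), and then
   dist(L, L') |y| >= |P y|; conversely a reflection of L achieves
   dist(L, L') |y| <= |P y|.  Hence grass_cond B is the least c such that
   |y| <= c |P y| for all y >= 0.

   On the other side, the transpose M of the oblique projection attached to a
   positive diagonal D fixes D L pointwise, where now L is the image of A, and
   M x depends only on P x, with P (M x) = P x.  So |z| <= ||M|| |P z| for z in
   D L, and bounding ||M|| amounts to bounding |z| / |P z| over D L.  As D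
   varies, the sets D L cover, up to closure, exactly the orthants met by L;
   these are the positive orthants seen after the admissible sign changes. *)

Set Implicit Arguments.
Unset Strict Implicit.
Unset Printing Implicit Defensive.

(** * Euclidean inner product and norm *)

Definition dot (R : realType) (d : nat) (x y : 'cV[R]_d) : R := (x^T *m y) 0 0.

Section Euclidean.
Variable R : realType.

Section Dot.
Variable d : nat.
Implicit Types (x y z : 'cV[R]_d) (a b : R).

Lemma dotE x y : dot x y = \sum_i x i 0 * y i 0.
Proof. by rewrite /dot mxE; apply: eq_bigr => i _; rewrite !mxE. Qed.

Lemma dotC x y : dot x y = dot y x.
Proof. by rewrite !dotE; apply: eq_bigr => i _; rewrite mulrC. Qed.

Lemma dotDr x y z : dot x (y + z) = dot x y + dot x z.
Proof. by rewrite /dot mulmxDr mxE. Qed.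

Lemma dotZr a x y : dot x (a *: y) = a * dot x y.
Proof. by rewrite /dot -scalemxAr mxE. Qed.

Lemma dotNr x y : dot x (- y) = - dot x y.
Proof. by rewrite /dot mulmxN mxE. Qed.

Lemma dotDl x y z : dot (y + z) x = dot y x + dot z x.
Proof. by rewrite dotC dotDr !(dotC x). Qed.

Lemma dotZl a x y : dot (a *: y) x = a * dot y x.
Proof. by rewrite dotC dotZr dotC. Qed.

Lemma dotNl x y : dot (- y) x = - dot y x.
Proof. by rewrite dotC dotNr dotC. Qed.

Lemma dot0r x : dot x 0 = 0.
Proof. by rewrite /dot mulmx0 mxE. Qed.

Lemma dot_ge0 x : 0 <= dot x x.
Proof. by rewrite dotE sumr_ge0// => i _; rewrite -expr2 sqr_ge0. Qed.

Lemma dot_eq0 x : dot x x = 0 -> x = 0.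
Proof.
by move=> x0; apply: trmulmx_eq0; apply/matrixP => i j; rewrite !ord1 [RHS]mxE.
Qed.

Lemma dot_gt0 x : x != 0 -> 0 < dot x x.
Proof.
by move=> x0; rewrite lt0r dot_ge0 andbT; apply: contra_neq x0 => /dot_eq0.
Qed.

Lemma enorm_ge0 x : 0 <= enorm x.
Proof. exact: sqrtr_ge0. Qed.

Lemma enorm_sqr x : enorm x ^+ 2 = dot x x.
Proof.
rewrite sqr_sqrtr ?sumr_ge0// => [|i _]; last exact: sqr_ge0.
by rewrite dotE; apply: eq_bigr => i _; rewrite expr2.
Qed.

Lemma enorm_gt0 x : x != 0 -> 0 < enorm x.
Proof.
move=> x0; rewrite lt0r enorm_ge0 andbT -sqrf_eq0 enorm_sqr.
by rewrite gt_eqF// dot_gt0.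
Qed.

Lemma enorm0 : enorm (0 : 'cV[R]_d) = 0.
Proof. by apply/eqP; rewrite -sqrf_eq0 enorm_sqr dot0r. Qed.

Lemma enormZ a x : enorm (a *: x) = `|a| * enorm x.
Proof.
apply/eqP; rewrite -(@eqrXn2 _ 2)// ?mulr_ge0 ?enorm_ge0 ?normr_ge0//.
by rewrite exprMn !enorm_sqr dotZr dotZl mulrA -expr2 real_normK ?num_real//.
Qed.

Lemma dot_le x y : dot x y <= enorm x * enorm y.
Proof.
have [->|y0] := eqVneq y 0; first by rewrite dot0r enorm0 mulr0.
rewrite (le_trans (ler_norm _))//.
rewrite -(@ler_pXn2r _ 2)// ?nnegrE ?mulr_ge0 ?enorm_ge0 ?normr_ge0//.
rewrite real_normK ?num_real// exprMn !enorm_sqr.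
(* Up to the factor [dot y y], this vector is the component of [x] orthogonal to [y]; its squared
   length is b (a b - c^2). *)
have := dot_ge0 (dot y y *: x - dot x y *: y).
rewrite !(dotDl, dotDr, dotNl, dotNr, dotZl, dotZr) (dotC y x).
set b := dot y y; set c := dot x y; set a := dot x x.
rewrite [leRHS](_ : _ = b * (a * b - c ^+ 2)); last by ring.
by rewrite pmulr_rge0 ?subr_ge0// dot_gt0.
Qed.

Lemma enormD x y : enorm (x + y) <= enorm x + enorm y.
Proof.
rewrite -(@ler_pXn2r _ 2)// ?nnegrE ?addr_ge0 ?enorm_ge0//.
rewrite enorm_sqr sqrrD !enorm_sqr !(dotDl, dotDr) (dotC y x).
by have := dot_le x y; lra.
Qed.

Lemma enormN x : enorm (- x) = enorm x.
Proof. by rewrite -scaleN1r enormZ normrN1 mul1r. Qed.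

(* Bessel's inequality for the orthogonal pair p, r, cleared of denominators. *)
Lemma bessel2 p r x : dot p r = 0 ->
  dot r r * dot p x ^+ 2 + dot p p * dot r x ^+ 2 <=
  dot p p * dot r r * dot x x.
Proof.
move=> pr0; have rp0 : dot r p = 0 by rewrite dotC.
set N := leLHS.
have N0 : 0 <= N by rewrite addr_ge0// mulr_ge0 ?dot_ge0 ?sqr_ge0.
have [->|Npos] := eqVneq N 0; first by rewrite !mulr_ge0 ?dot_ge0.
(* [t] is chosen so that its product with [x] is [N] itself; Cauchy-Schwarz then bounds N^2 by [N]
   times the right-hand side, and [N] cancels. *)
pose t := (dot p p * dot r x) *: r + (dot r r * dot p x) *: p.
have tx : dot x t = N.
  by rewrite /t /N !(dotDr, dotZr) (dotC x r) (dotC x p); ring.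
have tt : dot t t = dot p p * dot r r * N.
  by rewrite /t /N !(dotDl, dotDr, dotZl, dotZr) pr0 rp0; ring.
have := dot_le x t; rewrite tx.
rewrite -(@ler_pXn2r _ 2)// ?nnegrE ?mulr_ge0 ?enorm_ge0//.
rewrite exprMn !enorm_sqr tt expr2.
rewrite [leRHS](_ : _ = N * (dot p p * dot r r * dot x x)); last by ring.
by rewrite ler_pM2l// lt0r Npos.
Qed.

End Dot.

(** * Transposes and the operator norm *)

Lemma dot_mulmxr p q (M : 'M[R]_(p, q)) x y : dot x (M *m y) = dot (M^T *m x) y.
Proof. by rewrite /dot trmx_mul trmxK mulmxA. Qed.

(** For y = M^T x, |y|^2 = x . M y <= c |x| |y|. This moves bounds between the oblique projection
    and its transpose. *)
Lemma enorm_tr_le p q (M : 'M[R]_(p, q)) c : 0 <= c ->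
    (forall x, enorm (M *m x) <= c * enorm x) ->
  forall x, enorm (M^T *m x) <= c * enorm x.
Proof.
move=> c0 hM x; set y := M^T *m x.
have [->|y0] := eqVneq y 0; first by rewrite enorm0 mulr_ge0 ?enorm_ge0.
rewrite -(ler_pM2r (enorm_gt0 y0)) -expr2 enorm_sqr {1}/y -dot_mulmxr.
rewrite (le_trans (dot_le _ _))//.
by rewrite mulrAC mulrC ler_wpM2r ?enorm_ge0.
Qed.

Lemma mulmx_bounded p q (M : 'M[R]_(p, q)) :
  exists2 c, 0 <= c & forall x, enorm (M *m x) <= c * enorm x.
Proof.
(* The Frobenius norm: Cauchy-Schwarz is applied row by row. *)
exists (Num.sqrt (\sum_i dot (row i M)^T (row i M)^T)).
  exact: sqrtr_ge0.
move=> x; rewrite -(@ler_pXn2r _ 2)// ?nnegrE ?mulr_ge0 ?enorm_ge0 ?sqrtr_ge0//.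
rewrite exprMn !enorm_sqr sqr_sqrtr; last first.
  by rewrite sumr_ge0// => i _; exact: dot_ge0.
rewrite dotE mulr_suml ler_sum// => i _.
have -> : (M *m x) i 0 = dot (row i M)^T x.
  by rewrite /dot trmxK -row_mul [RHS]mxE.
rewrite -!enorm_sqr -expr2 -exprMn -real_normK ?num_real//.
rewrite lerXn2r ?nnegrE ?mulr_ge0 ?enorm_ge0//.
rewrite ler_norml dot_le andbT lerNl -dotNr.
by rewrite (le_trans (dot_le _ _))// enormN.
Qed.

Section OpNorm.
Variables p q : nat.
Implicit Type M : 'M[R]_(p, q).

Lemma opnorm_has_sup M :
  has_sup [set enorm (M *m x) | x in [set x : 'cV[R]_q | enorm x <= 1]].
Proof.
split; first by exists (enorm (M *m 0)), 0 => //=; rewrite enorm0.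
have [c c0 hc] := mulmx_bounded M; exists c => _ [x /= x1 <-].
by rewrite (le_trans (hc x))// ler_piMr.
Qed.

Lemma opnorm_ge0 M : 0 <= opnorm M.
Proof.
apply: (ub_le_sup (opnorm_has_sup M).2).
by exists 0 => /=; rewrite ?mulmx0 enorm0.
Qed.

Lemma enorm_mulmx_le M x : enorm (M *m x) <= opnorm M * enorm x.
Proof.
have [->|x0] := eqVneq x 0; first by rewrite mulmx0 !enorm0 mulr0.
have e0 := enorm_gt0 x0; rewrite -ler_pdivrMr// mulrC.
have -> : (enorm x)^-1 * enorm (M *m x) = enorm (M *m ((enorm x)^-1 *: x)).
  by rewrite -scalemxAr enormZ gtr0_norm// invr_gt0.
apply: (ub_le_sup (opnorm_has_sup M).2).
exists ((enorm x)^-1 *: x) => //=.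
by rewrite enormZ gtr0_norm ?invr_gt0// mulVf ?gt_eqF.
Qed.

Lemma opnorm_le M c : 0 <= c ->
  (forall x, enorm (M *m x) <= c * enorm x) -> opnorm M <= c.
Proof.
move=> c0 hM; apply: ge_sup; first by have [] := opnorm_has_sup M.
by move=> _ [x /= x1 <-]; rewrite (le_trans (hM x))// ler_piMr.
Qed.

End OpNorm.

Lemma enorm_trmulmx_le p q (M : 'M[R]_(p, q)) x :
  enorm (M^T *m x) <= opnorm M * enorm x.
Proof.
by apply: enorm_tr_le; [exact: opnorm_ge0 | exact: enorm_mulmx_le].
Qed.

End Euclidean.

(** * Small perturbations and Gordan's alternative *)

(** With e = 1/s each relative change e |l'_i / l_i| is below 1, so no nonzero entry changes sign.
    Zero entries of [l] add nothing to [s], as division by 0 yields 0. *)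
Lemma perturb_sign (R : realFieldType) m (l l' : 'cV[R]_m) :
  exists2 e, 0 < e & forall i, l i 0 != 0 -> 0 < l i 0 * (l + e *: l') i 0.
Proof.
pose s := 1 + \sum_i `|l' i 0 / l i 0|.
have s0 : 0 < s by rewrite ltr_pwDl// sumr_ge0.
exists s^-1; rewrite ?invr_gt0// => i li.
rewrite !mxE [ltRHS](_ : _ = l i 0 ^+ 2 * (1 + s^-1 * (l' i 0 / l i 0))).
  rewrite mulr_gt0 ?exprn_even_gt0// -ltrBlDl sub0r.
  suff : `|s^-1 * (l' i 0 / l i 0)| < 1 by rewrite ltr_norml => /andP[].
  rewrite normrM gtr0_norm ?invr_gt0// ltr_pdivrMl// mulr1.
  rewrite /s (bigD1 i)//= ltr_pwDl// lerDl.
  by rewrite sumr_ge0.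
by field; rewrite li lt0r_neq0.
Qed.

(* Induction on the rows: if the last row r is nonpositive on a vector x that is
   positive on the other rows, add to those multiples of r making x orthogonal
   to them, so that their values do not change when moving along x. *)
Lemma gordan (R : realFieldType) m n (B : 'M[R]_(m, n)) :
  (exists x : 'cV_n, forall i, 0 < (B *m x) i 0) \/
  (exists z : 'rV_m, [/\ z != 0, forall i, 0 <= z 0 i & z *m B = 0]).
Proof.
elim: m => [|m IH] in B *; first by left; exists 0; case.
move: B; rewrite -[m.+1]/(1 + m)%N => B.
rewrite -(vsubmxK B); move: (usubmx B) (dsubmx B) => r C {B}.
have [[x Cx]|[z [z0 zge zC]]] := IH C; last first.
  right; exists (row_mx 0 z); split.
  - by apply: contra_neq z0 => /(congr1 rsubmx); rewrite row_mxKr linear0.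
  - move=> i.
    by case: (split_ordP i) => j ->; rewrite (row_mxEl, row_mxEr) ?mxE.
  - by rewrite mul_row_col mul0mx zC addr0.
have posP (y : 'cV_n) : 0 < (r *m y) 0 0 -> (forall i, 0 < (C *m y) i 0) ->
    exists x : 'cV_n, forall i, 0 < (col_mx r C *m x) i 0.
  move=> ry Cy; exists y => i; rewrite mul_col_mx.
  by case: (split_ordP i) => j ->; rewrite (col_mxEu, col_mxEd) ?ord1.
have [r0|r0] := eqVneq r 0.
  right; exists (row_mx 1 0); split.
  - apply/eqP => /(congr1 lsubmx)/matrixP/(_ 0 0)/eqP.
    by rewrite row_mxKl !mxE oner_eq0.
  - move=> i; case: (split_ordP i) => j ->;
      by rewrite (row_mxEl, row_mxEr) !mxE ?ord1.
  - by rewrite mul_row_col r0 mulmx0 mul0mx addr0.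
have [rx|rx|rx0] := ltgtP 0 ((r *m x) 0 0); first by left; apply: (posP x).
- pose a := - (r *m x) 0 0; have a0 : 0 < a by rewrite oppr_gt0.
  have [lam lam0 Clam] : exists2 lam : 'cV_m,
      forall i, 0 < lam i 0 & C *m x = a *: lam.
    exists (a^-1 *: (C *m x)) => [i|]; first by rewrite mxE mulr_gt0 ?invr_gt0.
    by rewrite scalerA divff ?scale1r ?gt_eqF.
  (* The rows of C + lam r vanish at [x], since C x = a lam and r x = - a. *)
  have [[y Dy]|[z [z0 zge zD]]] := IH (C + lam *m r); last first.
    right; exists (row_mx (z *m lam) z); split.
    + by apply: contra_neq z0 => /(congr1 rsubmx); rewrite row_mxKr linear0.
    + move=> i; case: (split_ordP i) => j ->; rewrite (row_mxEl, row_mxEr)//.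
      by rewrite mxE sumr_ge0// => k _; rewrite ord1 mulr_ge0// ltW.
    + by rewrite mul_row_col -mulmxA addrC -mulmxDr.
  left; have [e e0 he] := perturb_sign ((C + lam *m r) *m y) (- lam).
  (* At this point [r] takes the value [e], and [C] the value (C + lam r) y - e lam, which is still
     positive for small [e]. *)
  apply: (posP (y + (((r *m y) 0 0 - e) / a) *: x)).
    rewrite mulmxDr -scalemxAr [ltRHS]mxE [X in _ + X]mxE.
    rewrite -[(r *m x) 0 0]opprK -/a.
    by rewrite mulrN divfK ?gt_eqF// opprB addrCA subrr addr0.
  move=> i; have := he i; rewrite gt_eqF// => /(_ isT); rewrite pmulr_rgt0//.
  congr (_ < _).
  have -> : (C + lam *m r) *m y = C *m y + (r *m y) 0 0 *: lam.
    rewrite mulmxDl -mulmxA; congr (_ + _); apply/matrixP => k j.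
    by rewrite !ord1 mxE big_ord1 mulrC [RHS]mxE.
  by rewrite mulmxDr -scalemxAr Clam scalerA divfK ?gt_eqF//
    scalerBl scalerN addrA.
(* Here r x = 0, so a small move along [r] itself makes r positive and keeps the other rows
   positive. *)
- left; have [e e0 he] := perturb_sign (C *m x) (C *m r^T).
  apply: (posP (x + e *: r^T)).
    rewrite mulmxDr -scalemxAr mxE -rx0 add0r mxE mulr_gt0//.
    rewrite lt0r mxE; apply/andP; split; last first.
      by rewrite sumr_ge0// => i _; rewrite mxE -expr2 sqr_ge0.
    apply: contra_neq r0; move/eqP; rewrite psumr_eq0; last first.
      by move=> i _; rewrite mxE -expr2 sqr_ge0.
    move=> /allP h; apply/matrixP => i j; rewrite !ord1 mxE.
    by have := h j (mem_index_enum _); rewrite mxE -expr2 sqrf_eq0 => /eqP.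
  move=> i; have := he i; rewrite gt_eqF// => /(_ isT); rewrite pmulr_rgt0//.
  by rewrite mulmxDr -scalemxAr.
Qed.

(** * Orthogonal projections onto images and subspaces *)

Section OrthogonalProjection.
Variables (R : realType) (m : nat).

Section Projection.
Variable L : {vspace 'cV[R]_m}.
Local Notation P := (oproj L).
Implicit Types x y : 'cV[R]_m.

Lemma oproj_mem x : P *m x \in L.
Proof. by have [] := oprojP L x. Qed.

Lemma dot_oproj_perp x y : y \in L -> dot y (x - P *m x) = 0.
Proof.
move=> yL; have [_ /(_ y yL)] := oprojP L x.
by rewrite /dot => ->; rewrite mxE.
Qed.

Lemma oproj_id x : x \in L -> P *m x = x.
Proof.
move=> xL; apply/esym/eqP; rewrite -subr_eq0; apply/eqP/dot_eq0.
by apply: dot_oproj_perp; rewrite rpredB// oproj_mem.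
Qed.

Lemma dot_oproj x y : dot (P *m x) y = dot x (P *m y).
Proof.
(* As v - P v is orthogonal to [L], the product equals P u . P v, which is symmetric in [u] and
   [v]. *)
have dotP u v : dot (P *m u) v = dot (P *m u) (P *m v).
  apply/eqP; rewrite -subr_eq0 -dotNr -dotDr.
  by rewrite dot_oproj_perp ?oproj_mem.
by rewrite dotP dotC -dotP dotC.
Qed.

Lemma oproj_tr : P^T = P.
Proof.
apply/matrixP => i j.
have := dot_oproj (delta_mx i 0) (delta_mx j 0).
rewrite dotC /dot !trmx_delta -!colE -!rowE !mxE.
by [].
Qed.

Lemma oproj_eq0 x : (forall y, y \in L -> dot y x = 0) -> P *m x = 0.
Proof.
move=> xL; apply: dot_eq0.
by rewrite dot_oproj oproj_id ?oproj_mem// dotC xL ?oproj_mem.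
Qed.

Lemma enorm_oproj_le x : enorm (P *m x) <= enorm x.
Proof.
have [->|Px] := eqVneq (P *m x) 0; first by rewrite enorm0 enorm_ge0.
rewrite -(ler_pM2r (enorm_gt0 Px)) -expr2 enorm_sqr dot_oproj.
by rewrite (oproj_id (oproj_mem x)) dot_le.
Qed.

End Projection.

Lemma oproj_mximage_perp n (B : 'M[R]_(m, n)) (x : 'cV_m) :
  B^T *m x = 0 -> oproj (mximage B) *m x = 0.
Proof.
move=> Bx; apply: oproj_eq0 => y /mximageP[c ->].
by rewrite dotC dot_mulmxr Bx dotC dot0r.
Qed.

(** The conjugate K P K^T has the defining property of the projection, so uniqueness applies. Used
    for reflections and for signatures. *)
Lemma oproj_mximage_orthogonal n (B : 'M[R]_(m, n)) (K : 'M[R]_m) :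
    K^T *m K = 1%:M ->
  oproj (mximage (K *m B)) = K *m oproj (mximage B) *m K^T.
Proof.
move=> KK; apply: is_oproj_unique; first exact: oprojP.
move=> x; split.
  have /mximageP[c Pc] := oproj_mem (mximage B) (K^T *m x).
  by apply/mximageP; exists c; rewrite -!mulmxA Pc.
move=> _ /mximageP[c ->].
suff e : dot (K *m B *m c) (x - K *m oproj (mximage B) *m K^T *m x) = 0.
  by apply/matrixP => i j; rewrite !ord1 [RHS]mxE.
rewrite -!mulmxA dotC dot_mulmxr mulmxBr (mulmxA K^T K) KK mul1mx dotC.
by rewrite dot_oproj_perp//; apply/mximageP; exists c.
Qed.

Lemma dim_mximage_mulmx n (B : 'M[R]_(m, n)) (K : 'M[R]_m) : K \in unitmx ->
  \dim (mximage (K *m B)) = \dim (mximage B).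
Proof.
move=> Ku.
have -> : mximage (K *m B) = (linfun (mulmx K) @: mximage B)%VS.
  apply/vspaceP => x; apply/idP/idP.
    move=> /mximageP[c ->]; apply/memv_imgP; exists (B *m c).
      by apply/mximageP; exists c.
    by rewrite lfunE/= mulmxA.
  move=> /memv_imgP[_ /mximageP[c ->] ->]; apply/mximageP; exists c.
  by rewrite lfunE/= mulmxA.
apply: limg_dim_eq; apply/eqP; rewrite -subv0; apply/subvP => x.
rewrite memv_cap memv_ker memv0 lfunE/= => /andP[_ /eqP Kx].
by rewrite -[x]mul1mx -(mulVmx Ku) -mulmxA Kx mulmx0.
Qed.

Lemma mximage_perp_exists n (B : 'M[R]_(m, n)) : (n < m)%N ->
  exists2 w : 'cV[R]_m, w != 0 & B^T *m w = 0.
Proof.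
move=> nm; have : kermx B != 0.
  rewrite kermx_eq0 /row_free; apply: contraTN nm => /eqP <-.
  by rewrite -leqNgt rank_leq_col.
move=> /rowV0Pn[v /sub_kermxP vB v0]; exists v^T.
  by apply: contra_neq v0 => /(congr1 trmx); rewrite trmxK trmx0.
by rewrite -trmx_mul vB trmx0.
Qed.

(** Gordan's alternative for the matrix P itself: its values lie in [L], and by symmetry its left
    kernel is its kernel. *)
Lemma gordan_vspace (L : {vspace 'cV[R]_m}) : ~ meets_pos L ->
  exists z : 'cV[R]_m, [/\ z != 0, forall i, 0 <= z i 0 & oproj L *m z = 0].
Proof.
move=> Lpos; have [[x xpos]|[z [z0 zge zP]]] := gordan (oproj L).
  by case: Lpos; exists (oproj L *m x); split => //=; exact: oproj_mem.
exists z^T; split.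
- by apply: contra_neq z0 => /(congr1 trmx); rewrite trmxK trmx0.
- by move=> i; rewrite mxE.
- by rewrite -oproj_tr -trmx_mul zP trmx0.
Qed.

End OrthogonalProjection.

(** * Householder reflections *)

Section Reflection.
Variables (R : realType) (m : nat).
Implicit Types h x y : 'cV[R]_m.

Definition reflection h : 'M[R]_m := 1%:M - (2 / dot h h) *: (h *m h^T).

Lemma reflectionE h x : reflection h *m x = x - (2 / dot h h * dot h x) *: h.
Proof.
rewrite mulmxBl mul1mx -scalemxAl -mulmxA -scalerA; congr (_ - _ *: _).
by apply/matrixP => i j; rewrite !ord1 mxE big_ord1 mulrC [RHS]mxE.
Qed.

Lemma reflection_tr h : (reflection h)^T = reflection h.
Proof. by rewrite linearB/= linearZ/= trmx1 trmx_mul trmxK. Qed.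

Lemma reflectionK h : h != 0 -> reflection h *m reflection h = 1%:M.
Proof.
move=> /dot_gt0/lt0r_neq0 h0.
suff rK x : reflection h *m (reflection h *m x) = x.
  apply/matrixP => i j.
  have := rK (delta_mx j 0).
  by rewrite mulmxA -colE => /matrixP/(_ i 0); rewrite !mxE eqxx andbT.
rewrite !reflectionE dotDr dotNr dotZr -addrA -opprD -scalerDl.
rewrite [X in X *: h](_ : _ = 0) ?scale0r ?subr0//.
by field.
Qed.

Lemma enorm_reflection h x : h != 0 -> enorm (reflection h *m x) = enorm x.
Proof.
move=> h0; apply/eqP; rewrite -(@eqrXn2 _ 2)// ?enorm_ge0//.
by rewrite !enorm_sqr dot_mulmxr reflection_tr mulmxA reflectionK// mul1mx.
Qed.

(* The equality enorm x = enorm y is what makes x - y the normal of a mirror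
   exchanging x and y. *)
Lemma reflection_swap x y : x != y -> enorm x = enorm y ->
  reflection (x - y) *m x = y.
Proof.
move=> xy exy; rewrite reflectionE.
have : x - y != 0 by rewrite subr_eq0.
move=> /dot_gt0/lt0r_neq0 h0.
suff -> : 2 / dot (x - y) (x - y) * dot (x - y) x = 1.
  by rewrite scale1r opprB addrC subrK.
have e : 2 * dot (x - y) x = dot (x - y) (x - y).
  have : dot x x = dot y y by rewrite -!enorm_sqr exy.
  by rewrite !(dotDl, dotDr, dotNl, dotNr) (dotC y x); lra.
by rewrite mulrAC e divff.
Qed.

End Reflection.

(** With p = P h and r = h - p, the commutator sends x to a multiple of (r . x) p - (p . x) r. As p
    and r are orthogonal, Bessel bounds its length by |p| |r| |x|. *)
Lemma enorm_reflection_commutator (R : realType) m (L : {vspace 'cV[R]_m})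
    (h x : 'cV[R]_m) :
  enorm (reflection h *m (oproj L *m x) - oproj L *m (reflection h *m x)) <=
  2 / dot h h * (enorm (oproj L *m h) * enorm (h - oproj L *m h)) * enorm x.
Proof.
set p := oproj L *m h; set r := h - p; set t := 2 / dot h h.
have pr0 : dot p r = 0 by apply: dot_oproj_perp; exact: oproj_mem.
have t0 : 0 <= t by rewrite divr_ge0 ?dot_ge0.
have -> : reflection h *m (oproj L *m x) - oproj L *m (reflection h *m x) =
    t *: (dot r x *: p - dot p x *: r).
  rewrite !reflectionE -/t mulmxBr -scalemxAr -/p -dot_oproj -/p.
  have -> : h = p + r by rewrite addrC subrK.
  rewrite dotDl; apply/matrixP => i j; rewrite !mxE; ring.
rewrite enormZ ger0_norm//; clearbody t r; rewrite -!mulrA ler_wpM2l//.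
rewrite -(@ler_pXn2r _ 2)// ?nnegrE ?mulr_ge0 ?enorm_ge0//.
rewrite !exprMn !enorm_sqr mulrA.
apply: le_trans (bessel2 x pr0).
rewrite !(dotDl, dotDr, dotNl, dotNr, dotZl, dotZr) pr0 (dotC r p) pr0.
by rewrite le_eqVlt; apply/orP; left; apply/eqP; ring.
Qed.

(** * The Grassmannian condition number as a best constant *)

Section GrassmannianCondition.
Variables (R : realType) (m n : nat) (B : 'M[R]_(m, n)).
Hypothesis nm : (n < m)%N.
Local Notation L := (mximage B).
Local Notation P := (oproj (mximage B)).
Implicit Types x y : 'cV[R]_m.

(* L' is the mirror image of L under the reflection taking y to a vector e
   orthogonal to L, chosen in the plane of y and its projection. *)
Lemma perp_subspace_exists y : P *m y != 0 ->
  exists L' : {vspace 'cV[R]_m}, [/\ \dim L' = \dim L,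
    forall x, x \in L' -> dot x y = 0 &
    grass_dist L L' * enorm y <= enorm (P *m y)].
Proof.
move=> Py0; have y0 : y != 0 by apply: contra_neq Py0 => ->; rewrite mulmx0.
have s0 := enorm_gt0 y0; set s := enorm y in s0 *.
(* [w] spans the direction of y - P y; if [y] lies in [L], any nonzero vector orthogonal to [L]
   serves, and n < m provides one. *)
have [w [w0 Pw [b yb]]] : exists w, [/\ w != 0, P *m w = 0 &
    exists b, y - P *m y = b *: w].
  have [yP|yP] := eqVneq (y - P *m y) 0.
    have [w w0 Bw] := mximage_perp_exists B nm; exists w; split => //.
      exact: oproj_mximage_perp.
    by exists 0; rewrite scale0r.
  exists (y - P *m y); split => //; last by exists 1; rewrite scale1r.
  by rewrite mulmxBr (oproj_id (oproj_mem _ _)) subrr.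
have {w w0 Pw b yb} [e [es Pe [b yb]]] : exists e, [/\ enorm e = s, P *m e = 0 &
    exists b, y - P *m y = b *: e].
  have ew := enorm_gt0 w0; exists ((s / enorm w) *: w); split.
  - by rewrite enormZ gtr0_norm ?divr_gt0// divfK ?gt_eqF.
  - by rewrite -scalemxAr Pw scaler0.
  - exists (b / (s / enorm w)).
    by rewrite scalerA divfK// gt_eqF// divr_gt0.
set h := y - e.
have Ph : P *m h = P *m y by rewrite mulmxBr Pe subr0.
have h0 : h != 0 by apply: contra_neq Py0 => hh; rewrite -Ph hh mulmx0.
have rE : h - P *m h = (b - 1) *: e.
  by rewrite Ph /h addrAC yb scalerBl scale1r.
have hh : dot h h = 2 * (1 - b) * s ^+ 2.
  have ye : dot y e = b * s ^+ 2.
    have -> : y = P *m y + b *: e by rewrite -yb addrC subrK.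
    by rewrite dotDl dotZl dot_oproj Pe dot0r add0r -es enorm_sqr.
  rewrite /h !(dotDl, dotDr, dotNl, dotNr) (dotC e y) ye -!enorm_sqr es -/s.
  by ring.
have b1 : 0 < 1 - b.
  by have := dot_gt0 h0; rewrite hh pmulr_lgt0 ?exprn_gt0// pmulr_rgt0.
have HH := reflectionK h0.
exists (mximage (reflection h *m B)); split.
- by apply: dim_mximage_mulmx; have [] := mulmx1_unit HH.
- move=> _ /mximageP[c ->].
  rewrite -mulmxA dotC dot_mulmxr reflection_tr.
  rewrite reflection_swap ?es//; last by rewrite -subr_eq0.
  have <- : P *m (B *m c) = B *m c by apply: oproj_id; apply/mximageP; exists c.
  by rewrite dotC dot_oproj Pe dot0r.
rewrite -ler_pdivlMr//; apply: opnorm_le; first by rewrite divr_ge0 ?enorm_ge0.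
move=> x; rewrite oproj_mximage_orthogonal ?reflection_tr//.
(* H is an involution, so P - H P H = H (H P - P H), and H preserves lengths: only the commutator
   matters. Its bound simplifies to |P y| / |y|, the factors 1 - b cancelling. *)
have -> : (P - reflection h *m P *m reflection h) *m x =
    reflection h *m (reflection h *m (P *m x) - P *m (reflection h *m x)).
  move: (reflection h) HH => H HH.
  by rewrite mulmxBr (mulmxA _ _ (P *m x)) HH mul1mx mulmxBl -!mulmxA.
rewrite enorm_reflection// (le_trans (enorm_reflection_commutator _ _ _))//.
rewrite rE Ph enormZ es hh -normrN opprB gtr0_norm//.
rewrite le_eqVlt; apply/orP; left; apply/eqP; field.
by rewrite !gt_eqF.
Qed.

Lemma dot_pos_gt0 x y : pos_orthant R m x -> y != 0 ->
  (forall i, 0 <= y i 0) -> 0 < dot x y.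
Proof.
move=> xpos y0 yge; have xy0 i : 0 <= x i 0 * y i 0.
  by rewrite mulr_ge0// ltW.
rewrite lt0r dotE sumr_ge0// andbT; apply: contra_neq y0.
move=> /eqP; rewrite psumr_eq0// => /allP h.
apply/matrixP => i j; rewrite ord1 mxE.
by have := h i (mem_index_enum _); rewrite /= mulf_eq0 gt_eqF//= => /eqP.
Qed.

Lemma enorm_le_sum y : (forall i, 0 <= y i 0) -> enorm y <= \sum_i y i 0.
Proof.
move=> yge; rewrite -(@ler_pXn2r _ 2)// ?nnegrE ?enorm_ge0 ?sumr_ge0//.
rewrite enorm_sqr dotE expr2 mulr_suml ler_sum// => i _.
by rewrite ler_wpM2l// (bigD1 i)//= lerDl sumr_ge0.
Qed.

Lemma const_mx1_neq0 : const_mx 1 != 0 :> 'cV[R]_m.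
Proof.
apply/eqP => /matrixP/(_ (Ordinal (leq_ltn_trans (leq0n n) nm)) 0)/eqP.
by rewrite !mxE oner_eq0.
Qed.

Hypothesis Lpos : meets_pos L.

(** For [x] in [L] with all entries above e > 0, |x| |P y| >= x . P y = x . y >= e |y|. This keeps
    the infimum of distances away from 0, so its inverse is meaningful. *)
Lemma oproj_nonneg_lower :
  exists2 k, 0 < k & forall y, (forall i, 0 <= y i 0) ->
    k * enorm y <= enorm (P *m y).
Proof.
have [x [/= xL xpos]] := Lpos.
(* Subtracting [e] from every entry keeps [x] positive, which gives a uniform lower bound on the
   entries. *)
have [e e0 xe] := perturb_sign x (const_mx (-1)).
have {}xe i : e < x i 0.
  have := xe i; rewrite gt_eqF// => /(_ isT); rewrite pmulr_rgt0// !mxE.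
  by rewrite mulrN1 subr_gt0.
have x0 : 0 < enorm x.
  apply: enorm_gt0; apply/eqP => x0.
  have := xpos (Ordinal (leq_ltn_trans (leq0n n) nm)).
  by rewrite x0 mxE ltxx.
exists (e / enorm x); first exact: divr_gt0.
move=> y yge; rewrite mulrAC ler_pdivrMr// [leRHS]mulrC.
apply: le_trans (dot_le _ _); rewrite -dot_oproj oproj_id// dotE.
apply: le_trans (_ : e * \sum_i y i 0 <= _).
  by rewrite ler_pM2l// enorm_le_sum.
by rewrite mulr_sumr ler_sum// => i _; rewrite ler_wpM2r// ltW.
Qed.

Let dists := [set grass_dist L L'
  | L' in [set L' : {vspace 'cV[R]_m} | \dim L' = \dim L /\ ~ meets_pos L']].

(** The reflected subspace is orthogonal to [y], whereas a positive vector has positive product with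
    [y]. *)
Lemma grass_dist_attained y : y != 0 -> (forall i, 0 <= y i 0) ->
  exists2 r, dists r & r * enorm y <= enorm (P *m y).
Proof.
move=> y0 yge; have Py0 : P *m y != 0.
  have [k k0 /(_ _ yge) hk] := oproj_nonneg_lower; apply/eqP => Py.
  by move: hk; rewrite Py enorm0 leNgt mulr_gt0// enorm_gt0.
have [L' [dL' yL' dist]] := perp_subspace_exists Py0.
exists (grass_dist L L') => //.
exists L' => //=; split => //.
move=> [x [/= /yL' xy xpos]].
by have := dot_pos_gt0 xpos y0 yge; rewrite xy ltxx.
Qed.

(** The Gordan vector [z] of L' is killed by the projection onto L', so P z is the difference of the
    two projections applied to [z]. *)
Lemma dists_ge k : (forall y, (forall i, 0 <= y i 0) ->
    k * enorm y <= enorm (P *m y)) ->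
  lbound dists k.
Proof.
move=> hk _ [L' /= [_ L'pos] <-].
have [z [z0 zge zL']] := gordan_vspace L'pos.
rewrite -(ler_pM2r (enorm_gt0 z0)) (le_trans (hk _ zge))//.
rewrite (_ : P *m z = (P - oproj L') *m z) ?enorm_mulmx_le//.
by rewrite mulmxBl zL' subr0.
Qed.

Lemma dists_neq0 : dists !=set0.
Proof.
have [|r ?] := grass_dist_attained const_mx1_neq0; last by exists r.
by move=> i; rewrite mxE.
Qed.

Lemma inf_dists_gt0 : 0 < inf dists.
Proof.
have [k k0 hk] := oproj_nonneg_lower.
by apply: lt_le_trans k0 (lb_le_inf dists_neq0 (dists_ge hk)).
Qed.

Lemma grass_cond_ge0 : 0 <= grass_cond B.
Proof. by rewrite invr_ge0 ltW// inf_dists_gt0. Qed.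

Lemma enorm_le_grass_cond y : (forall i, 0 <= y i 0) ->
  enorm y <= grass_cond B * enorm (P *m y).
Proof.
move=> yge; have [->|y0] := eqVneq y 0; first by rewrite mulmx0 enorm0 mulr0.
rewrite mulrC ler_pdivlMr ?inf_dists_gt0// mulrC.
have [r rd] := grass_dist_attained y0 yge; apply: le_trans.
rewrite ler_pM2r ?enorm_gt0//; apply: ge_inf => //.
by have [k _ hk] := oproj_nonneg_lower; exists k; exact: dists_ge.
Qed.

Lemma grass_cond_le c : (forall y, (forall i, 0 <= y i 0) ->
  enorm y <= c * enorm (P *m y)) -> grass_cond B <= c.
Proof.
move=> hc.
(* The bound at the nonzero all-ones vector forces c > 0, so inverses can be compared. *)
have c0 : 0 < c.
  have := hc (const_mx 1); rewrite ltNge => hy; apply/negP => c0.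
  have : enorm (const_mx 1 : 'cV[R]_m) <= 0.
    by rewrite (le_trans (hy _))// ?mulr_le0_ge0 ?enorm_ge0// => i; rewrite mxE.
  by rewrite leNgt enorm_gt0// const_mx1_neq0.
rewrite -[leRHS]invrK lef_pV2 ?posrE ?invr_gt0 ?inf_dists_gt0//.
apply: (lb_le_inf dists_neq0); apply: dists_ge => y yge.
by rewrite ler_pdivrMl// hc.
Qed.

End GrassmannianCondition.

(** * Signature matrices *)

Section Signatures.
Variables (R : realType) (m : nat).

Lemma signature_mx_tr (S : 'M[R]_m) : signature_mx R m S -> S^T = S.
Proof. by move=> [s _ <-]; rewrite tr_diag_mx. Qed.

Lemma signature_mxK (S : 'M[R]_m) : signature_mx R m S -> S *m S = 1%:M.
Proof.
move=> [s hs <-]; rewrite mulmx_diag; apply/matrixP => i j; rewrite !mxE.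
by case: (hs i) => ->; rewrite ?mulrNN mulr1.
Qed.

Lemma enorm_signature (S : 'M[R]_m) x : signature_mx R m S ->
  enorm (S *m x) = enorm x.
Proof.
move=> hS; apply/eqP; rewrite -(@eqrXn2 _ 2)// ?enorm_ge0// !enorm_sqr.
by rewrite dot_mulmxr signature_mx_tr// mulmxA signature_mxK// mul1mx.
Qed.

Lemma oproj_signature n (A : 'M[R]_(m, n)) S x : signature_mx R m S ->
  enorm (oproj (mximage (S *m A)) *m x) = enorm (oproj (mximage A) *m (S *m x)).
Proof.
move=> hS; rewrite oproj_mximage_orthogonal; last first.
  by rewrite signature_mx_tr// signature_mxK.
by rewrite signature_mx_tr// -!mulmxA enorm_signature.
Qed.

(** Signatures are coded by the finitely many boolean functions on the indices, so a maximiser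
    exists. *)
Lemma signature_max (X : set 'M[R]_m) (F : 'M[R]_m -> R) :
    X `<=` signature_mx R m -> X !=set0 ->
  exists2 S, X S & forall S', X S' -> F S' <= F S.
Proof.
move=> Xs [S0 XS0].
pose D (s : {ffun 'I_m -> bool}) : 'M[R]_m := diag_mx (\row_i (-1) ^+ s i).
have DX S : signature_mx R m S -> exists s, D s = S.
  move=> [s hs <-]; exists [ffun i => s 0 i == -1]; congr diag_mx.
  apply/rowP => i; rewrite mxE ffunE; case: (hs i) => ->; rewrite ?eqxx//.
  by rewrite gt_eqF//; lra.
have [s0 Ds0] := DX _ (Xs _ XS0).
have Ps0 : [pred s | `[< X (D s) >]] s0 by apply/asboolP; rewrite Ds0.
have [s /asboolP Xs1 smax] := arg_maxP (F \o D) Ps0.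
exists (D s) => // S' XS'; have [s' Ds'] := DX _ (Xs _ XS').
by rewrite -Ds'; apply: smax; apply/asboolP; rewrite Ds'.
Qed.

End Signatures.

(** * Oblique projections and the sign patterns of the image *)

Section Oblique.
Variables (R : realType) (m n : nat) (A : 'M[R]_(m, n)).
Hypothesis Arank : \rank A = n.

Lemma mulmx_tr_oproj (x : 'cV[R]_m) :
  A^T *m (oproj (mximage A) *m x) = A^T *m x.
Proof.
apply/esym/eqP; rewrite -subr_eq0 -mulmxBr; apply/eqP/colP => i.
set r := x - _; have -> : (A^T *m r) i 0 = dot (col i A) r.
  by rewrite /dot tr_col -row_mul [RHS]mxE.
rewrite mxE dot_oproj_perp//; apply/mximageP; exists (delta_mx i 0).
exact: colE.
Qed.

(** For positive diagonal [D], this is the projection onto the image L of [A] along the orthogonal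
    complement of D L. *)
Definition oblique_proj (D : 'M[R]_m) : 'M[R]_m :=
  A *m invmx (A^T *m D *m A) *m A^T *m D.

(** The quadratic form at [v] is a positively weighted sum of squares of the entries of v A^T; it
    vanishes only if v A^T = 0, and full rank then gives v = 0. *)
Lemma weighted_gram_unit (d : 'rV[R]_m) : (forall i, 0 < d 0 i) ->
  A^T *m diag_mx d *m A \in unitmx.
Proof.
move=> d0; rewrite -row_free_unit; apply: inj_row_free => v vG.
have AT : row_free A^T by rewrite /row_free mxrank_tr Arank.
apply: (row_free_inj AT); rewrite mul0mx; apply/rowP => i; rewrite [RHS]mxE.
have : \sum_j d 0 j * (v *m A^T) 0 j ^+ 2 = 0.
  transitivity ((v *m (A^T *m diag_mx d *m A) *m v^T) 0 0); last first.
    by rewrite vG mul0mx mxE.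
  have -> : v *m (A^T *m diag_mx d *m A) *m v^T =
      v *m A^T *m diag_mx d *m (v *m A^T)^T by rewrite trmx_mul trmxK !mulmxA.
  rewrite mul_mx_diag [RHS]mxE; apply: eq_bigr => j _.
  by rewrite [in RHS]mxE [(v *m A^T)^T _ _]mxE; ring.
move=> /eqP; rewrite psumr_eq0 => [/allP h|j _]; last first.
  by rewrite mulr_ge0 ?sqr_ge0// ltW.
by have := h i (mem_index_enum _); rewrite mulf_eq0 gt_eqF//= sqrf_eq0 => /eqP.
Qed.

Section Transpose.
Variable d : 'rV[R]_m.
Hypothesis d0 : forall i, 0 < d 0 i.
Local Notation D := (diag_mx d).

Lemma oblique_proj_tr :
  (oblique_proj D)^T = D *m A *m invmx (A^T *m D *m A) *m A^T.
Proof.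
by rewrite /oblique_proj !trmx_mul trmx_inv !trmx_mul trmxK tr_diag_mx !mulmxA.
Qed.

Lemma oblique_proj_tr_perp (x : 'cV[R]_m) :
  A^T *m ((oblique_proj D)^T *m x) = A^T *m x.
Proof.
by rewrite oblique_proj_tr !mulmxA mulmxV ?weighted_gram_unit// mul1mx.
Qed.

Lemma oblique_proj_tr_id (c : 'cV[R]_n) :
  (oblique_proj D)^T *m (D *m (A *m c)) = D *m (A *m c).
Proof.
rewrite oblique_proj_tr -!mulmxA; congr (_ *m (_ *m _)).
rewrite !mulmxA -(mulmxA _ A^T) -(mulmxA _ _ A).
by rewrite mulVmx ?weighted_gram_unit// mul1mx.
Qed.

(** The transpose changes [x] only by a vector in the kernel of A^T, hence orthogonal to the image
    of [A]. *)
Lemma oproj_oblique_tr (x : 'cV[R]_m) :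
  oproj (mximage A) *m ((oblique_proj D)^T *m x) = oproj (mximage A) *m x.
Proof.
apply/eqP; rewrite -subr_eq0 -mulmxBr oproj_mximage_perp//.
by rewrite mulmxBr oblique_proj_tr_perp subrr.
Qed.

Lemma oblique_proj_tr_oproj (x : 'cV[R]_m) :
  (oblique_proj D)^T *m (oproj (mximage A) *m x) = (oblique_proj D)^T *m x.
Proof.
by rewrite oblique_proj_tr -!(mulmxA _ A^T) mulmx_tr_oproj.
Qed.

End Transpose.

Hypothesis Arows : forall i, row i A != 0.

Lemma mximage_all_neq0 : exists c : 'cV[R]_n, forall i, (A *m c) i 0 != 0.
Proof.
suff /(_ m (leqnn m))[c hc] : forall k, (k <= m)%N ->
    exists c : 'cV[R]_n, forall i : 'I_m, (i < k)%N -> (A *m c) i 0 != 0.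
  by exists c => i; apply: hc.
elim=> [|k IH] km; first by exists 0.
have [c hc] := IH (ltnW km); pose k' := Ordinal km.
have [ck|ck] := eqVneq ((A *m c) k' 0) 0; last first.
  exists c => i; rewrite ltnS leq_eqVlt => /orP[/eqP ik|]; last exact: hc.
  by rewrite (_ : i = k')//; exact: val_inj.
(* Moving along row [k'] makes that entry e |row|^2 > 0 and keeps the earlier entries nonzero. *)
have [e e0 he] := perturb_sign (A *m c) (A *m (row k' A)^T).
exists (c + e *: (row k' A)^T) => i.
rewrite ltnS leq_eqVlt mulmxDr -scalemxAr => /orP[/eqP ik|/hc/he]; last first.
  by apply: contraTneq => ->; rewrite mulr0 ltxx.
have -> : i = k' by exact: val_inj.
rewrite mxE ck add0r mxE mulf_neq0 ?(lt0r_neq0 e0)//.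
rewrite (_ : _ 0 = dot (row k' A)^T (row k' A)^T); last first.
  by rewrite /dot trmxK -row_mul [RHS]mxE.
rewrite lt0r_neq0// dot_gt0//.
by apply: contra_neq (Arows k') => /(congr1 trmx); rewrite trmxK trmx0.
Qed.

(* Zero entries of A c are first made nonzero by a small perturbation inside the
   image of A. *)
Lemma signature_cover (c : 'cV[R]_n) (d : 'rV[R]_m) : (forall i, 0 < d 0 i) ->
  exists S, [/\ signature_mx R m S, meets_pos (mximage (S *m A)) &
    forall i, 0 <= (S *m (diag_mx d *m (A *m c))) i 0].
Proof.
move=> d0; have [c1 hc1] := mximage_all_neq0.
have [e e0 he] := perturb_sign (A *m c) (A *m c1).
have {}he i : (A *m c) i 0 != 0 -> 0 < (A *m c) i 0 * (A *m (c + e *: c1)) i 0.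
  by rewrite mulmxDr -scalemxAr; exact: he.
have hx i : (A *m (c + e *: c1)) i 0 != 0.
  have [ci|/he] := eqVneq ((A *m c) i 0) 0; last first.
    by apply: contraTneq => ->; rewrite mulr0 ltxx.
  rewrite mulmxDr -scalemxAr mxE ci add0r mxE.
  by apply: mulf_neq0; [exact: lt0r_neq0 | exact: hc1].
move: (c + _) he hx => x he hx.
(* The signs are those of A x, which has no zero entry and agrees in sign with A c wherever A c is
   nonzero; [d] is positive and changes no sign. *)
exists (diag_mx (\row_i Num.sg ((A *m x) i 0))); split.
- eexists; last reflexivity; move=> i /=; rewrite mxE.
  by case: sgrP (hx i) => //; rewrite ?eqxx//; [right|left].
- exists (diag_mx (\row_i Num.sg ((A *m x) i 0)) *m A *m x); split => /=.
    by apply/mximageP; exists x.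
  move=> i; rewrite -mulmxA mul_diag_mx mxE.
  by rewrite [X in X * _]mxE -normrEsg normr_gt0.
- move=> i; rewrite !mul_diag_mx mxE [X in X * _]mxE [X in _ * X]mxE.
  rewrite mulrCA mulr_ge0 ?(ltW (d0 i))//.
  have [->|/he] := eqVneq ((A *m c) i 0) 0; first by rewrite mulr0.
  rewrite {1}[(A *m x) i 0]numEsg mulrA [X in X * _]mulrC.
  by rewrite pmulr_lgt0 ?normr_gt0// => /ltW.
Qed.

Hypothesis nm : (n < m)%N.

Let norms := [set opnorm (oblique_proj D) | D in pos_diag_mx R m].

Let good : set 'M[R]_m :=
  [set S | signature_mx R m S /\ meets_pos (mximage (S *m A))].

(** For the transpose M, z = M x lies in D L, and some good S makes S z nonnegative. Then |z| <= g
    |P z| = g |P x| <= g |x|. *)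
Lemma opnorm_oblique_le g D : 0 <= g -> pos_diag_mx R m D ->
    (forall S, good S -> grass_cond (S *m A) <= g) ->
  opnorm (oblique_proj D) <= g.
Proof.
move=> g0 [d d0 <-] hg; apply: opnorm_le => // x.
rewrite -[oblique_proj _]trmxK; apply: enorm_tr_le => // {}x.
have [S [Ssign Spos Sz]] :=
  signature_cover (invmx (A^T *m diag_mx d *m A) *m (A^T *m x)) d0.
set z := diag_mx d *m _ in Sz.
have zE : (oblique_proj (diag_mx d))^T *m x = z.
  by rewrite oblique_proj_tr /z !mulmxA.
rewrite zE -(enorm_signature z Ssign).
apply: le_trans (enorm_le_grass_cond nm Spos Sz) _.
rewrite oproj_signature// (mulmxA S S) signature_mxK// mul1mx.
rewrite -zE oproj_oblique_tr//.
by rewrite ler_pM ?hg ?enorm_ge0 ?enorm_oproj_le// grass_cond_ge0.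
Qed.

(** A strictly positive [u] is handled by a suitable [D]; a nonnegative [y] is then the limit of y +
    t x. *)
Lemma enorm_le_oblique_bound c : ubound norms c -> 0 <= c ->
  forall S (y : 'cV[R]_m), good S -> (forall i, 0 <= y i 0) ->
  enorm y <= c * enorm (oproj (mximage (S *m A)) *m y).
Proof.
move=> hc c0 S y [Ssign [x [/= xL xpos]]] yge.
set P := oproj _.
have open (u : 'cV[R]_m) : (forall i, 0 < u i 0) ->
    enorm u <= c * enorm (P *m u).
  move=> u0; have /mximageP[a xE] := xL.
  (* These ratios give u = D x, so S u = D S x lies in D L, where the transposed oblique projection
     is the identity. *)
  pose d := \row_i (u i 0 / x i 0).
  have d0 i : 0 < d 0 i by rewrite mxE divr_gt0.
  have uE : S *m u = diag_mx d *m (A *m a).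
    have -> : A *m a = S *m x by rewrite xE !mulmxA signature_mxK// mul1mx.
    have [s _ <-] := Ssign; apply/colP => i.
    rewrite !mul_diag_mx !mxE mulrCA divfK ?gt_eqF//.
  rewrite /P oproj_signature// -(enorm_signature u Ssign).
  rewrite {1}uE -oblique_proj_tr_id// -uE -oblique_proj_tr_oproj.
  rewrite (le_trans (enorm_trmulmx_le _ _))// ler_wpM2r ?enorm_ge0//.
  by apply: hc; exists (diag_mx d) => //; exists d.
apply/ler_addgt0Pr => e e0.
have K0 : 0 < c * enorm (P *m x) + enorm x + 1.
  by rewrite ltr_wpDl// addr_ge0 ?mulr_ge0 ?enorm_ge0.
(* Passing from [y] to y + t x costs at most t K, and this [t] makes it at most [e]; the 1 avoids
   division by 0. *)
set K := c * _ + enorm x in K0; pose t := e / (K + 1).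
have t0 : 0 < t by rewrite divr_gt0.
have hu i : 0 < (y + t *: x) i 0 by rewrite !mxE ltr_wpDl// mulr_gt0.
have := enormD (y + t *: x) (- (t *: x)).
rewrite addrK enormN enormZ gtr0_norm// => /le_trans; apply.
apply: le_trans (lerD (open _ hu) (lexx _)) _.
have : enorm (P *m (y + t *: x)) <= enorm (P *m y) + t * enorm (P *m x).
  by rewrite mulmxDr -scalemxAr (le_trans (enormD _ _))// enormZ gtr0_norm.
move=> /(ler_wpM2l c0) h.
have tK : t * K <= e.
  by rewrite mulrAC ler_pdivrMr// ler_pM2l// lerDl.
apply: le_trans (lerD h (lexx _)) _.
rewrite mulrDr -addrA lerD2l; apply: le_trans tK.
by rewrite /K mulrDr mulrCA.
Qed.

End Oblique.

(** * The two bounds combined *)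

Theorem corollary2 (R : realType) (m n : nat) (A : 'M[R]_(m, n))
    (hnm : (n < m)%N)
    (hrank : \rank A = n)
    (hrows : forall i : 'I_m, row i A != 0) :
  is_maximum
    [set grass_cond (S *m A)
    | S in [set S | signature_mx R m S /\ meets_pos (mximage (S *m A))]]
    (chi_bar A).
Proof.
have one_gt0 i : 0 < (const_mx 1 : 'rV[R]_m) 0 i by rewrite mxE.
have [||S [Ssign Spos] Smax] :=
    signature_max (X :=
      [set S | signature_mx R m S /\ meets_pos (mximage (S *m A))])
    (fun S => grass_cond (S *m A)).
- by move=> S [].
- by have [S [? ? _]] := signature_cover hrows 0 one_gt0; exists S.
set norms := [set opnorm (oblique_proj A D) | D in pos_diag_mx R m].
have chiE : chi_bar A = sup norms by [].
have norms0 : norms !=set0.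
  exists (opnorm (oblique_proj A (diag_mx (const_mx 1)))).
  by eexists; last reflexivity; exists (const_mx 1).
(* This also shows that the norms are bounded, so [sup] is a true supremum rather than its default
   value. *)
have normsub : ubound norms (grass_cond (S *m A)).
  move=> _ [D Dpos <-]; apply: opnorm_oblique_le => //; exact: grass_cond_ge0.
have chi_le : chi_bar A <= grass_cond (S *m A) by rewrite chiE; exact: ge_sup.
have normschi : ubound norms (chi_bar A).
  by move=> r nr; rewrite chiE; apply: ub_le_sup nr;
    exists (grass_cond (S *m A)).
have chi0 : 0 <= chi_bar A.
  have [r nr] := norms0; apply: le_trans (normschi r nr).
  by case: nr => D _ <-; exact: opnorm_ge0.
have chi_ub S' : signature_mx R m S' -> meets_pos (mximage (S' *m A)) ->
    grass_cond (S' *m A) <= chi_bar A.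
  move=> S's S'p; apply: grass_cond_le => // y.
  by apply: enorm_le_oblique_bound.
split; last by move=> _ [S' [S's S'p] <-]; exact: chi_ub.
by exists S => //; apply/eqP; rewrite eq_le chi_ub.
Qed.
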